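(* Let $B, K, M$ be the Billey–Jockusch–Stanley, Krattenthaler, and Mansour–Deng–Du bijections from Dyck paths to $321$-avoiding permutations, let $L$ be the Kreweras–Lalanne involution on Dyck paths, and let $L'$ be the derivative of $L$ (all as defined in the context). Then, as maps on the set of all Dyck paths, $$M = B\circ L = K\circ L'.$$ That is, $M(P)=B(L(P))=K(L'(P))$ for every Dyck path $P$.
   Context: Dyck paths. A Dyck path is a lattice path with an equal number of upsteps $u=(1,1)$ and downsteps $d=(1,-1)$ that never dips below ground level, the horizontal line connecting its endpoints. Its size is its number of upsteps; a Dyck $n$-path is one of size $n$. The empty Dyck path is denoted $\epsilon$. An ascent is a maximal sequence of contiguous upsteps and a descent is a maximal sequence of contiguous downsteps. A Dyck path is elevated if it is nonempty and its only return to ground level occurs at its end. Every nonempty Dyck path decomposes uniquely as a concatenation of elevated Dyck paths, called its components; each component has the form $u\,P\,d$ with $P$ a (possibly empty) Dyck path. Composition is $(f\circ g)(x)=f(g(x))$. Partial-sum ascent-descent code. For $n\ge 1$, let a Dyck $n$-path have $k$ peaks (occurrences of $ud$), ascent lengths $a_1,\dots,a_k$ and descent lengths $d_1,\dots,d_k$, in order. Put $r=k-1$, $A_i=\sum_{j\le i}a_j$ and $D_i=\sum_{j\le i}d_j$. The code of the path is the pair $\big((A_i)_{i=1}^{r},(D_i)_{i=1}^{r}\big)$. For given $n$ the path is determined by its code, and the codes of Dyck $n$-paths are exactly the pairs with $0\le r\le n-1$, $1\le A_1<\cdots<A_r\le n-1$, $1\le D_1<\cdots<D_r\le n-1$, and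 $A_i\ge D_i$ for $1\le i\le r$. Involution $L$. For a Dyck $n$-path $P$ with $n\ge 1$, label the upsteps $1,\dots,n$ from left to right and the downsteps $1,\dots,n$ from left to right. Let $t=(t_i)$ be the increasing sequence of labels of the first $u$ in each occurrence of $uu$ (two consecutive upsteps), and let $h=(h_i)$ be the increasing sequence of labels of the first $d$ in each occurrence of $dd$. These have the same length, and $(h,t)$ is a valid code. Define $L(P)$ to be the Dyck $n$-path whose partial-sum ascent-descent code is $(A,D)=(h,t)$. Also $L(\epsilon)=\epsilon$. Derivative. For a size-preserving bijection $F$ on Dyck paths, its derivative $F'$ is defined by $F'(\epsilon)=\epsilon$ and $F'(uP_1d\;uP_2d\cdots uP_\ell d)=uF(P_1)d\;uF(P_2)d\cdots uF(P_\ell)d$, where $uP_1d,\dots,uP_\ell d$ are the components of the path. Bijection $B$. For a Dyck $n$-path with code $(A_i)_{i=1}^r,(D_i)_{i=1}^r$, its image under $B$ is the permutation $\pi$ of $[n]=\{1,\dots,n\}$ with $\pi(D_i)=A_i+1$ for $1\le i\le r$, and with the remaining values placed in the remaining positions in increasing order. Bijection $K$. For a Dyck $n$-path with code $(A_i)_{i=1}^r,(D_i)_{i=1}^r$, set $D_0=0$ and $A_{r+1}=n$. Its image under $K$ is the permutation $\pi$ of $[n]$ with $\pi(D_{i-1}+1)=A_i$ for $1\le i\le r+1$, and with the remaining values placed in the remaining positions in increasing order. Bijection $M$. For a Dyck $n$-path $P$ with $n\ge 1$, with its upsteps labelled $1,\dots,n$ from left to right and its downsteps labelled $1,\dots,n$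 from left to right, let $h=(h_1,\dots,h_r)$ be the increasing sequence of labels of the first $d$ in each occurrence of $dd$ in $P$, and let $t=(t_1,\dots,t_r)$ be the increasing sequence of labels of the first $u$ in each occurrence of $uu$ in $P$. Let $s_j$ be the operation on lists that interchanges the entries in positions $j$ and $j+1$, and let $\sigma_i=s_{h_i}s_{h_i-1}\cdots s_{t_i}$. Then $M(P)$ is the permutation, in one-line notation, $(1,2,\dots,n)\,\sigma_1\sigma_2\cdots\sigma_r$, where all operations are applied successively from left to right. All three bijections send $\epsilon$ to the empty permutation. *)

(* Defs.v *)
From HB Require Import structures.
From mathcomp Require Import all_boot.
From mathcomp Require Import zify.

Set Implicit Arguments.
Unset Strict Implicit.
Unset Printing Implicit Defensive.

(* A lattice path is the word of its steps, [true] being u and [false] d. *)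
Notation up := true (only parsing).
Notation down := false (only parsing).

(* From height [h], the path stays at or above height 0 and ends at height 0. *)
Fixpoint dyck_from (h : nat) (w : seq bool) : bool :=
  match w with
  | [::] => h == 0
  | c :: w' => if c then dyck_from h.+1 w'
               else if h is h'.+1 then dyck_from h' w' else false
  end.

Record dyck := Dyck { dyck_word :> seq bool; dyckP : dyck_from 0 dyck_word }.

HB.instance Definition _ := [isSub for dyck_word].
HB.instance Definition _ := [Equality of dyck by <:].

Definition dsize (w : seq bool) : nat := count_mem up w.

Lemma dyck_from_cat g h v w :
  dyck_from g v -> dyck_from (g + h) (v ++ w) = dyck_from h w.
Proof.
elim: v g => [|[] v IHv] g /=; first by move/eqP->.
  by move=> /IHv <-.
by case: g => // g /IHv <-.
Qed.

Lemma dyck_from_up g m w : dyck_from g (nseq m up ++ w) = dyck_from (g + m) w.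
Proof. by elim: m g => [|m IHm] g /=; rewrite ?addn0 // IHm addSnnS. Qed.

Lemma dyck_from_down g m w :
  dyck_from (g + m) (nseq m down ++ w) = dyck_from g w.
Proof. by elim: m => [|m IHm] /=; rewrite ?addn0 // addnS. Qed.

Definition dyck_empty : dyck := @Dyck [::] isT.

Lemma elevate_subproof (P : dyck) : dyck_from 0 (up :: rcons P down).
Proof. by rewrite /= -cats1 -(add0n 1) dyck_from_cat // dyckP. Qed.

Definition elevate (P : dyck) : dyck := Dyck (elevate_subproof P).

Lemma dyck_cat_subproof (P Q : dyck) : dyck_from 0 (P ++ Q).
Proof. by rewrite -(add0n 0) dyck_from_cat dyckP. Qed.

Definition dyck_cat (P Q : dyck) : dyck := Dyck (dyck_cat_subproof P Q).

(* [:: P_1; ...; P_l] |-> u P_1 d u P_2 d ... u P_l d *)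
Definition join (Ps : seq dyck) : dyck :=
  foldr (fun P Q => dyck_cat (elevate P) Q) dyck_empty Ps.

(* The words P_1, ..., P_l of u P_1 d ... u P_l d, read from left to right:   *)
(* [h] is the current height and [cur] is what has been read of the current   *)
(* component after its initial u.                                             *)
Fixpoint components_rec (h : nat) (cur : seq bool) (w : seq bool) :
    seq (seq bool) :=
  match w with
  | [::] => [::]
  | c :: w' =>
    if c then
      if h == 0 then components_rec 1 [::] w'
      else components_rec h.+1 (rcons cur up) w'
    else
      if h == 1 then cur :: components_rec 0 [::] w'
      else components_rec h.-1 (rcons cur down) w'
  end.

(* [pmap insub] drops nothing here: see [componentsK] and [joinK]. *)
Definition components (P : dyck) : seq dyck :=
  pmap insub (components_rec 0 [::] P).

Lemma componentsK (P : dyck) : join (components P) = P.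
Proof.
apply: val_inj; rewrite /= /components.
suff H h cur w : dyck_from h w ->
    (forall v, 0 < h -> dyck_from 0 (cur ++ v) = dyck_from h.-1 v) ->
    join (pmap insub (components_rec h cur w))
      = (if h == 0 then [::] else up :: cur) ++ w :> seq bool.
  by rewrite H // dyckP.
elim: w h cur => [|[] w IHw] h cur /=; first by move/eqP->.
  case: h => [|h] Hw Hc /=; first by rewrite IHw.
  rewrite IHw //= ?cat_rcons // => v _.
  by rewrite cat_rcons Hc.
case: h => [|[|h]] //= Hw Hc; last first.
  rewrite IHw //= ?cat_rcons // => v _.
  by rewrite cat_rcons Hc.
have Dcur : dyck_from 0 cur by rewrite -[cur]cats0 Hc.
rewrite insubT /= IHw //=.
by rewrite cat_rcons.
Qed.

Lemma joinK (Ps : seq dyck) : components (join Ps) = Ps.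
Proof.
have H g h cur v w : dyck_from g v ->
    components_rec (g + h.+1) cur (v ++ w) = components_rec h.+1 (cur ++ v) w.
  elim: v g cur => [|[] v IHv] g cur /=; first by rewrite cats0 => /eqP->.
    move=> Hv; rewrite addnS /= -addSn -addnS.
    by rewrite (IHv g.+1) // cat_rcons.
  case: g => // g Hv; rewrite !addnS !addSn /= -addnS.
  by rewrite IHv // cat_rcons.
rewrite /components; elim: Ps => //= P Ps IHPs.
rewrite cat_rcons -(add0n 1) H ?dyckP //=.
by rewrite insubT ?dyckP //= => DP; congr cons => //; apply: val_inj.
Qed.

Definition derivative (F : dyck -> dyck) (P : dyck) : dyck :=
  join (map F (components P)).

Lemma derivativeE F (Ps : seq dyck) :
  derivative F (join Ps) = join (map F Ps).
Proof. by rewrite /derivative joinK. Qed.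

(* Lengths of the maximal runs of [b]: the ascent lengths when [b] is [up],   *)
(* the descent lengths when [b] is [down].                                    *)
Fixpoint runs (b : bool) (w : seq bool) : seq nat :=
  match w with
  | [::] => [::]
  | c :: w' =>
    if c != b then runs b w'
    else if head (~~ b) w' == b then incr_nth (runs b w') 0
    else 1 :: runs b w'
  end.

Definition psums (r : nat) (s : seq nat) : seq nat :=
  [seq sumn (take i s) | i <- iota 1 r].

(* The number k of peaks is the number of ascents, and r = k - 1. *)
Definition codeA (w : seq bool) : seq nat :=
  psums (size (runs up w)).-1 (runs up w).
Definition codeD (w : seq bool) : seq nat :=
  psums (size (runs up w)).-1 (runs down w).

Definition diffs (s : seq nat) : seq nat := pairmap (fun x y => y - x) 0 s.

(* u^(A_1) d^(D_1) u^(A_2 - A_1) d^(D_2 - D_1) ... u^(n - A_r) d^(n - D_r) *)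
Definition path_of_code (n : nat) (A D : seq nat) : seq bool :=
  flatten [seq nseq x.1 up ++ nseq x.2 down
          | x <- zip (diffs (rcons A n)) (diffs (rcons D n))].

(* Labels of the first letter of each occurrence of bb, when the occurrences  *)
(* of [b] in [w] are labelled k + 1, k + 2, ... from left to right.           *)
Fixpoint double_labels_from (b : bool) (k : nat) (w : seq bool) : seq nat :=
  match w with
  | [::] => [::]
  | c :: w' =>
    if c != b then double_labels_from b k w'
    else if head (~~ b) w' == b then k.+1 :: double_labels_from b k.+1 w'
    else double_labels_from b k.+1 w'
  end.

Definition tlabels (w : seq bool) : seq nat := double_labels_from up 0 w.
Definition hlabels (w : seq bool) : seq nat := double_labels_from down 0 w.

(* A word with peaks given by [s]: ascent and descent lengths are x.1 + 1 and *)
(* x.2 + 1 for x in [s].                                                      *)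
Definition blocks (s : seq (nat * nat)) : seq bool :=
  flatten [seq nseq x.1.+1 up ++ nseq x.2.+1 down | x <- s].

Lemma blocks_ex (P : dyck) : exists s, P = blocks s :> seq bool.
Proof.
suff H h w : dyck_from h w -> exists m s, w = nseq m down ++ blocks s.
  have [[|m] [s Ps]] := H _ _ (dyckP P); first by exists s.
  by have := dyckP P; rewrite Ps.
elim: w h => [|[] w IHw] h /=; first by exists 0, [::].
  move=> /[dup] Dw /IHw[[|m] [s ws]]; last first.
    by exists 0, ((0, m) :: s); rewrite ws.
  case: s ws => [|[a d] s] ws; first by rewrite ws in Dw.
  by exists 0, ((a.+1, d) :: s); rewrite ws.
by case: h => // h /IHw[m [s ->]]; exists m.+1, s.
Qed.

Lemma head_blocks b s : head up (nseq b up ++ blocks s) = up.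
Proof. by case: b => //; case: s. Qed.

Lemma double_labels_up k s :
  double_labels_from up k (blocks s) =
  if s is x :: s' then
    iota k.+1 x.1 ++ double_labels_from up (k + x.1.+1) (blocks s')
  else [::].
Proof.
case: s => //= -[a d] s /=; elim: a k => [|a IHa] k /=.
  by rewrite addn1; elim: d.
by rewrite IHa addSnnS.
Qed.

Lemma double_labels_down k s :
  double_labels_from down k (blocks s) =
  if s is x :: s' then
    iota k.+1 x.2 ++ double_labels_from down (k + x.2.+1) (blocks s')
  else [::].
Proof.
case: s => //= -[a d] s /=; rewrite -catA.
elim: a => [|a //] /=; elim: d k => [|d IHd] k /=.
  by rewrite addn1; case: s.
by rewrite IHd addSnnS.
Qed.

(* Ends of the ascents, resp. descents, of [blocks s]. *)
Fixpoint ends (k : nat) (s : seq nat) : seq nat :=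
  if s is x :: s' then (k + x.+1) :: ends (k + x.+1) s' else [::].

Definition total (s : seq nat) : nat := sumn [seq x.+1 | x <- s].

Lemma dsize_blocks s : dsize (blocks s) = total (unzip1 s).
Proof.
rewrite /dsize /total; elim: s => //= -[a d] s IHs /=.
by rewrite !count_cat /= !count_nseq IHs /=; lia.
Qed.

Lemma dyck_blocks g a d s :
  dyck_from g (blocks ((a, d) :: s)) =
  (d <= g + a) && dyck_from (g + a - d) (blocks s).
Proof.
have -> : blocks ((a, d) :: s) = nseq a.+1 up ++ (nseq d.+1 down ++ blocks s).
  by rewrite catA.
rewrite dyck_from_up; case: leqP => [da|lt_ad]; rewrite ?andTb ?andFb.
  have -> : g + a.+1 = (g + a - d) + d.+1 by lia.
  by rewrite dyck_from_down.
have: g + a.+1 < d.+1 by lia.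
by elim: (g + a.+1) d.+1 {lt_ad} => [|l IHl] [|m] //=; apply: IHl.
Qed.

Lemma dyck_blocks_total g s :
  dyck_from g (blocks s) -> g + total (unzip1 s) = total (unzip2 s).
Proof.
rewrite /total; elim: s g => [|[a d] s IHs] g; first by move/eqP->.
by rewrite dyck_blocks /= => /andP[da /IHs]; lia.
Qed.

Lemma dyck_blocks_ends k l s :
  dyck_from k (blocks s) =
  all2 geq (ends (k + l) (unzip1 s)) (ends l (unzip2 s)) &&
  (k + total (unzip1 s) == total (unzip2 s)).
Proof.
rewrite /total; elim: s k l => [|[a d] s IHs] k l; first by rewrite /= addn0.
rewrite dyck_blocks /= (IHs _ (l + d.+1)).
have -> : (l + d.+1 <= k + l + a.+1) = (d <= k + a) by lia.
case: leqP => //= da.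
have -> : k + a - d + (l + d.+1) = k + l + a.+1 by lia.
by congr (_ && _); lia.
Qed.

Fixpoint doubles (k : nat) (s : seq nat) : seq nat :=
  if s is x :: s' then iota k.+1 x ++ doubles (k + x.+1) s' else [::].

Lemma tlabels_blocks s : tlabels (blocks s) = doubles 0 (unzip1 s).
Proof.
rewrite /tlabels; elim: s 0 => [//|x s IHs] k.
by rewrite double_labels_up IHs.
Qed.

Lemma hlabels_blocks s : hlabels (blocks s) = doubles 0 (unzip2 s).
Proof.
rewrite /hlabels; elim: s 0 => [//|x s IHs] k.
by rewrite double_labels_down IHs.
Qed.

Lemma size_doubles k s : size (doubles k s) + size s = total s.
Proof.
rewrite /total; elim: s k => //= x s IHs k.
rewrite size_cat size_iota -(IHs (k + x.+1)); lia.
Qed.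

Lemma count_doubles x k s :
  count (geq x) (doubles k s) + count (geq x) (ends k s) =
  minn (x - k) (total s).
Proof.
rewrite /total; elim: s k => [|a s IHs] k /=; first by rewrite minn0.
rewrite count_cat addnACA IHs.
have -> : count (geq x) (iota k.+1 a) = minn (x - k) a; last first.
  have -> : (x >= k + a.+1)%N = (k + a < x) by lia.
  by case: ltnP => ? /=; lia.
elim: a k {IHs} => [|a IHa] k /=; first by rewrite minn0.
by rewrite IHa; case: leqP => ? /=; lia.
Qed.

Lemma doubles_sorted k s : path ltn k (doubles k s).
Proof.
suff H m : m <= k -> path ltn m (doubles k s) by exact: H.
elim: s k m => //= a s IHs k m mk.
elim: a k m mk => [|a IHa] k m mk /=; first by apply: IHs; lia.
by rewrite ltnS mk /= addnS -addSn; apply: IHa.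
Qed.

Lemma doubles_lt k s x : x \in doubles k s -> x < k + total s.
Proof.
rewrite /total; elim: s k => //= a s IHs k; rewrite mem_cat mem_iota.
case/orP => [|/IHs]; lia.
Qed.

(* [(A, D)] is the code of a Dyck [n]-path. *)
Definition valid_code (n : nat) (A D : seq nat) : bool :=
  [&& sorted ltn A, sorted ltn D, all (fun x => 0 < x < n) A,
      all (fun x => 0 < x < n) D & all2 geq A D].

Lemma sorted_count_leq (s t : seq nat) :
  sorted ltn s -> sorted ltn t -> size s = size t ->
  (forall x, count (geq x) s <= count (geq x) t) -> all2 geq s t.
Proof.
elim: s t => [|x s IHs] [|y t] //= xs yt [st] c.
have le_all a u z : path ltn a u -> z < a -> count (geq z) u = 0.
  rewrite (path_sortedE ltn_trans) => /andP[/allP au _] za.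
  apply/eqP; rewrite -leqn0 leqNgt -has_count; apply/hasPn => v /au.
  by rewrite /= -ltnNge; apply: ltn_trans.
have yx : y <= x.
  rewrite leqNgt; apply/negP => xy.
  by have := c x; rewrite /= leqnn (le_all y t) // [y <= x]leqNgt xy.
rewrite yx /=; apply: IHs => //; rewrite ?(path_sorted xs) ?(path_sorted yt) //.
move=> z; have := c z => /=.
case: (leqP y z) => yz; case: (leqP x z) => xz //=; try lia.
by rewrite (le_all x s z).
Qed.

Lemma labels_valid (P : dyck) :
  valid_code (dsize P) (hlabels P) (tlabels P).
Proof.
have [s Ps] := blocks_ex P; have DP := dyckP P; rewrite Ps in DP *.
have /= tot := dyck_blocks_total DP; rewrite add0n in tot.
have le_ends : all2 geq (ends 0 (unzip1 s)) (ends 0 (unzip2 s)).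
  by move: DP; rewrite (dyck_blocks_ends 0 0) => /andP[].
rewrite tlabels_blocks hlabels_blocks dsize_blocks /valid_code.
have dlt r : all (fun x => 0 < x < total r) (doubles 0 r).
  apply/allP => x xr; rewrite -[total r]add0n doubles_lt // andbT.
  have := doubles_sorted 0 r; rewrite (path_sortedE ltn_trans).
  by case/andP=> /allP/(_ _ xr).
have srt r : sorted ltn (doubles 0 r) := path_sorted (doubles_sorted 0 r).
rewrite {1}tot !dlt !srt /=; apply: sorted_count_leq => //.
  have := size_doubles 0 (unzip1 s); have := size_doubles 0 (unzip2 s).
  rewrite !size_map; lia.
move=> x; have := count_doubles x 0 (unzip1 s).
have := count_doubles x 0 (unzip2 s); rewrite tot.
have : count (geq x) (ends 0 (unzip1 s)) <= count (geq x) (ends 0 (unzip2 s)).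
  elim: (ends 0 (unzip1 s)) (ends 0 (unzip2 s)) le_ends => [|a A IH] [|d D] //=.
  case/andP=> da /IH; have [le|] := leqP a x => /=; last by lia.
  by rewrite (leq_trans da le).
lia.
Qed.

Lemma path_of_code_blocks n A D : 0 < n -> valid_code n A D ->
  exists s, [/\ path_of_code n A D = blocks s,
    ends 0 (unzip1 s) = rcons A n & ends 0 (unzip2 s) = rcons D n].
Proof.
move=> n_gt0 /and5P[sA sD aA aD AD].
have strict E : sorted ltn E -> all (fun x => 0 < x < n) E ->
    path ltn 0 (rcons E n).
  move=> sE /allP aE; rewrite (path_sortedE ltn_trans) all_rcons n_gt0 /=.
  apply/andP; split; first by apply/allP => x /aE /andP[].
  case: E sE aE => //= x E sE aE; rewrite rcons_path sE /=.
  by case/andP: (aE _ (mem_last x E)).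
have {AD} szAD : size A = size D by move: AD; rewrite all2E => /andP[/eqP].
have szR : size (rcons A n) = size (rcons D n) by rewrite !size_rcons szAD.
suff H E G a d : size E = size G -> path ltn a E -> path ltn d G ->
    exists s, [/\ flatten [seq nseq z.1 up ++ nseq z.2 down
        | z <- zip (pairmap (fun x y => y - x) a E)
                   (pairmap (fun x y => y - x) d G)] = blocks s,
      ends a (unzip1 s) = E & ends d (unzip2 s) = G].
  exact: H szR (strict A sA aA) (strict D sD aD).
elim: E G a d {szR} => [|x E IHE] [|y G] a d //=; first by exists [::].
case=> szE /andP[ax /(IHE G x) IHx] /andP[dy /(IHx y szE)[s [-> <- <-]]].
exists ((x - a.+1, y - d.+1) :: s); split=> /=.
- have [-> ->] : x - a = (x - a.+1).+1 /\ y - d = (y - d.+1).+1 by lia.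
  by [].
- by have -> : a + (x - a.+1).+1 = x by lia.
by have -> : d + (y - d.+1).+1 = y by lia.
Qed.

Lemma last_ends k s : last k (ends k s) = k + total s.
Proof. by rewrite /total; elim: s k => [|x s IHs] k /=; rewrite ?IHs; lia. Qed.

Lemma runs_up_blocks s : runs up (blocks s) = [seq x.1.+1 | x <- s].
Proof.
elim: s => //= -[a d] s <- /=; elim: a => [|a IHa] /=; first by elim: d.
by rewrite IHa.
Qed.

Lemma runs_down_blocks s : runs down (blocks s) = [seq x.2.+1 | x <- s].
Proof.
elim: s => //= -[a d] s <- /=; rewrite -catA.
elim: a => [|a //] /=; elim: d => [|d IHd] /=; first by case: s.
by rewrite IHd.
Qed.

Lemma psums_ends r s : r <= size s ->
  psums r [seq x.+1 | x <- s] = take r (ends 0 s).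
Proof.
suff H k : r <= size s ->
    [seq k + sumn (take i [seq x.+1 | x <- s]) | i <- iota 1 r] =
    take r (ends k s) by apply: (H 0).
elim: s k r => [|x s IHs] k [|r] //= rs; rewrite take0 addn0; congr cons.
rewrite -(IHs (k + x.+1) r rs) -(addn1 1) iotaDl -map_comp.
by apply: eq_map => i /=; rewrite addnA.
Qed.

Lemma path_of_code_dyck n A D :
  valid_code n A D -> dyck_from 0 (path_of_code n A D).
Proof.
case: n => [|n].
  by case: A D => [|a A] [|d D] /and5P[_ _] //=; rewrite ltn0 andbF.
move=> vAD; have [//|s [-> As Ds]] := path_of_code_blocks _ vAD.
have eqn : total (unzip1 s) = total (unzip2 s).
  by rewrite -[LHS]add0n -[RHS]add0n -!last_ends As Ds !last_rcons.
rewrite (dyck_blocks_ends 0 0) eqn eqxx andbT As Ds.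
case/and5P: vAD => _ _ _ _; rewrite !all2E !size_rcons => /andP[/eqP szAD al].
by rewrite szAD eqxx /= zip_rcons // all_rcons /= leqnn.
Qed.

Lemma path_of_codeK n A D : valid_code n A D ->
  [/\ dsize (path_of_code n A D) = n, codeA (path_of_code n A D) = A
     & codeD (path_of_code n A D) = D].
Proof.
case: n => [|n].
  by case: A D => [|a A] [|d D] /and5P[_ _] //=; rewrite ltn0 andbF.
move=> vAD; have [//|s [-> As Ds]] := path_of_code_blocks _ vAD.
have szE k r : size (ends k r) = size r by elim: r k => //= x r IHr k; rewrite IHr.
have szA := szE 0 (unzip1 s); rewrite As size_rcons size_map in szA.
have szD := szE 0 (unzip2 s); rewrite Ds size_rcons size_map in szD.
rewrite dsize_blocks /codeA /codeD runs_up_blocks runs_down_blocks.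
rewrite (map_comp S fst) (map_comp S snd) !size_map -szA /=.
split; first by rewrite -[LHS]add0n -last_ends As last_rcons.
  by rewrite psums_ends ?size_map -?szA // As -cats1 take_size_cat.
rewrite psums_ends ?size_map -?szA // Ds -cats1 take_size_cat //.
by case: szD; rewrite -szA => -[].
Qed.

Definition L (P : dyck) : dyck := Dyck (path_of_code_dyck (labels_valid P)).

(* Hence [L P] is the Dyck path of the size of [P] with code [(h, t)].        *)
Lemma LP (P : dyck) :
  [/\ dsize (L P) = dsize P, codeA (L P) = hlabels P & codeD (L P) = tlabels P].
Proof. exact: path_of_codeK (labels_valid P). Qed.

(* The permutation of [n], in one-line notation, with the i-th entry of       *)
(* [vals] in the i-th of the positions [pos] (counted from 1), and the        *)
(* remaining values in increasing order in the remaining positions.           *)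
Definition fill (n : nat) (pos vals : seq nat) : seq nat :=
  [seq if p \in pos then nth 0 vals (index p pos)
       else nth 0 [seq v <- iota 1 n | v \notin vals]
                  (count (fun q => q \notin pos) (iota 1 p.-1))
  | p <- iota 1 n].

(* Permutations are in one-line notation. *)
Definition B (P : dyck) : seq nat :=
  fill (dsize P) (codeD P) [seq a.+1 | a <- codeA P].

Definition K (P : dyck) : seq nat :=
  fill (dsize P) [seq d.+1 | d <- 0 :: codeD P] (rcons (codeA P) (dsize P)).

(* Interchanges the entries in positions j and j + 1, counted from 1. *)
Definition swap (s : seq nat) (j : nat) : seq nat :=
  set_nth 0 (set_nth 0 s j.-1 (nth 0 s j)) j (nth 0 s j.-1).

(* s_h s_(h-1) ... s_t, the leftmost operation being applied first. *)
Definition sigma (s : seq nat) (ht : nat * nat) : seq nat :=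
  foldl swap s (rev (iota ht.2 (ht.1.+1 - ht.2))).

Definition M (P : dyck) : seq nat :=
  foldl sigma (iota 1 (dsize P)) (zip (hlabels P) (tlabels P)).

(* Main.v *)
From mathcomp Require Import all_boot.
From mathcomp Require Import zify.
Require Import Defs.

Set Implicit Arguments.
Unset Strict Implicit.
Unset Printing Implicit Defensive.

(** Let t and h be the sequences of labels of the first steps of the occurrences
    of uu and of dd in a Dyck path P.

    The operator s_h ... s_t takes the entry in position h + 1 out of a list and
    reinserts it in position t.  Since h and t both increase and t_i <= h_i, the
    i-th operator of M finds the value h_i + 1 still at its initial place, and
    never disturbs the positions t_j filled before.  So M(P) has the value
    h_i + 1 in position t_i, and the other values are never permuted among
    themselves ([foldl_sigma_fills], [M_fills]).  As L(P) has code (h, t), this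
    is the prescription that defines B(L(P)), and a prescription of this kind
    has only one solution ([fills_fill]).

    For K(L'(P)), compare the pairs (position, value) prescribed by K for L'(P)
    with those prescribed by B for L(P).  On a component u Q d of size m with
    Q nonempty they are the same: the code of u L(Q) d is (h(Q) + 1, t(Q)), so K
    prescribes the positions 1, t(Q) + 1 and the values h(Q) + 1, m, while the
    doubled steps of u Q d are those of Q together with a first u and a last
    but one d ([code_elevate], [labels_elevate]).  On a component u d, K asks
    for 1 in position 1 and B asks for nothing, with the same result.  Both
    prescriptions turn concatenation of paths into direct sum of permutations
    ([fills_cat], [labels_cat], [Kpos_cat], [Kvals_cat]), so an induction on the
    components yields one permutation satisfying both ([fills_join]). *)

(** * Permutations with prescribed values *)

(** The prescription behind [fill], as a relation on lists: unlike the
    explicit formula, it is visibly preserved when an entry is moved to a newly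
    prescribed position, and by direct sums. *)
Definition fills (n : nat) (pos vals s : seq nat) : Prop :=
  [/\ perm_eq s (iota 1 n), all (fun p => 0 < p <= n) pos,
      [seq nth 0 s p.-1 | p <- pos] = vals
    & sorted ltn [seq v <- s | v \notin vals]].

Lemma nth_filter_count (a : pred nat) s i :
  i < size s -> a (nth 0 s i) ->
  nth 0 (filter a s) (count a (take i s)) = nth 0 s i.
Proof.
move=> i_s ai; rewrite -{1}(cat_take_drop i s) (drop_nth 0) // filter_cat /= ai.
by rewrite nth_cat size_filter ltnn subnn.
Qed.

(** A position is prescribed exactly when its entry is, because [s] has no
    repeated entry.  Hence the rank of an unprescribed position among the
    unprescribed ones is the rank of its entry in the increasing list of the
    unprescribed values. *)
Lemma fills_fill n pos vals s : fills n pos vals s -> fill n pos vals = s.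
Proof.
case=> s_perm /allP pos_n s_pos s_inc.
have sz_s : size s = n by rewrite (perm_size s_perm) size_iota.
have s_uniq : uniq s by rewrite (perm_uniq s_perm) iota_uniq.
have {}pos_n (p : nat) : p \in pos -> 0 < p <= n := pos_n p.
have in_vals q : 0 < q <= n -> (nth 0 s q.-1 \in vals) = (q \in pos).
  move=> q_n; apply/idP/idP => [|q_pos]; last first.
    by rewrite -s_pos; apply: (map_f (fun p => nth 0 s p.-1)).
  rewrite -s_pos => /mapP[p p_pos /eqP].
  have p_n := pos_n _ p_pos.
  rewrite nth_uniq // ?sz_s; try lia.
  by move=> /eqP eq_qp; have -> : q = p by lia.
have rest : [seq v <- iota 1 n | v \notin vals] = [seq v <- s | v \notin vals].
  apply: (irr_sorted_eq ltn_trans ltnn) => //.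
    exact: sorted_filter ltn_trans _ _ (iota_ltn_sorted _ _).
  by apply: perm_mem; apply: perm_filter; rewrite perm_sym.
rewrite /fill; apply: (@eq_from_nth _ 0).
  by rewrite size_map size_iota sz_s.
move=> i; rewrite size_map size_iota => i_n.
rewrite (nth_map 0) ?size_iota // nth_iota // add1n /= rest.
case: ifP => i_pos.
  rewrite -s_pos (nth_map 0) ?index_mem // nth_index //.
rewrite -[RHS](@nth_filter_count (fun v => v \notin vals)) ?sz_s //; last first.
  by rewrite (in_vals i.+1) ?i_pos.
congr nth.
have -> : take i s = [seq nth 0 s q.-1 | q <- iota 1 i].
  apply: (@eq_from_nth _ 0); rewrite size_take_min sz_s.
    by rewrite size_map size_iota; lia.
  move=> q q_i; rewrite nth_take ?(nth_map 0) ?size_iota ?nth_iota //; lia.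
rewrite count_map; apply: eq_in_count => q; rewrite mem_iota => q_i /=.
by rewrite in_vals //; lia.
Qed.

(** Direct sum of permutations: all entries of the second block exceed those of
    the first, so the unprescribed ones still increase. *)
Lemma fills_cat m n p1 p2 v1 v2 s1 s2 :
  fills m p1 v1 s1 -> fills n p2 v2 s2 ->
  fills (m + n) (p1 ++ map (addn m) p2) (v1 ++ map (addn m) v2)
    (s1 ++ map (addn m) s2).
Proof.
case=> perm1 /allP pos1 <- inc1 [perm2 /allP pos2 <- inc2].
have sz1 : size s1 = m by rewrite (perm_size perm1) size_iota.
have sz2 : size s2 = n by rewrite (perm_size perm2) size_iota.
have {}pos1 (p : nat) : p \in p1 -> 0 < p <= m := pos1 p.
have {}pos2 (p : nat) : p \in p2 -> 0 < p <= n := pos2 p.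
have le1 (x : nat) : x \in s1 -> 0 < x <= m.
  by rewrite (perm_mem perm1) mem_iota; lia.
have gt2 (x : nat) : x \in s2 -> 0 < x <= n.
  by rewrite (perm_mem perm2) mem_iota; lia.
set v1' := map _ p1; set v2' := map _ p2 in inc2 *.
have v1_le (x : nat) : x \in v1' -> 0 < x <= m.
  case/mapP=> /= p /pos1 p_m ->; apply/le1/mem_nth.
  by rewrite ?sz1 ?sz2; lia.
have v2_le (x : nat) : x \in v2' -> 0 < x <= n.
  case/mapP=> /= p /pos2 p_n ->; apply/gt2/mem_nth.
  by rewrite ?sz1 ?sz2; lia.
split.
- rewrite iotaD add1n -(addn1 m) iotaDl; apply: perm_cat => //.
  exact: perm_map.
- apply/allP => p; rewrite mem_cat => /orP[/pos1|/mapP[q /pos2 q_n ->]]; lia.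
- rewrite map_cat; congr cat.
    apply/eq_in_map => p /pos1 p_m; rewrite nth_cat sz1 ifT //; lia.
  rewrite -!map_comp; apply/eq_in_map => p /pos2 p_n /=.
  rewrite nth_cat sz1 ifF; last by lia.
  have -> : (m + p).-1 - m = p.-1 by lia.
  by rewrite (nth_map 0) //; lia.
rewrite filter_cat filter_map.
have -> : [seq x <- s1 | x \notin v1' ++ map (addn m) v2'] =
    [seq x <- s1 | x \notin v1'].
  apply: eq_in_filter => x /le1 x_m; rewrite mem_cat.
  suff /negPf-> : x \notin map (addn m) v2' by rewrite orbF.
  by apply/mapP => -[y /v2_le]; lia.
have -> : [seq x <- s2 | preim (addn m)
      [pred x | x \notin v1' ++ map (addn m) v2'] x] =
    [seq x <- s2 | x \notin v2'].
  apply: eq_in_filter => x /gt2 x_n /=.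
  rewrite mem_cat (mem_map (@addnI m)).
  suff /negPf-> : m + x \notin v1' by [].
  by apply/negP => /v1_le; lia.
rewrite !sorted_pairwise ?pairwise_cat; try exact: ltn_trans.
rewrite -!sorted_pairwise; try exact: ltn_trans.
apply/and3P; split => //; last first.
  by apply: homo_sorted inc2 => x y /=; rewrite ltn_add2l.
apply/allrelP => x y; rewrite mem_filter => /andP[_ /le1 x_m].
case/mapP=> z; rewrite mem_filter => /andP[_ /gt2 z_n] ->; lia.
Qed.

(** * The bijection M *)

(** The entry [v] travels left across the block [b], one swap per entry. *)
Lemma sigmaE a b v c :
  sigma (a ++ b ++ v :: c) (size a + size b, (size a).+1) = a ++ v :: b ++ c.
Proof.
rewrite /sigma /= -addSn addKn.
elim/last_ind: b v c => [|b x IHb] v c //.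
rewrite size_rcons -(addn1 (size b)) iotaD rev_cat /= !cat_rcons -IHb.
congr (foldl swap _ _); rewrite /swap addSn /=.
have nthE d (r : seq nat) :
    nth 0 (a ++ b ++ r) (size a + size b + d) = nth 0 r d.
  by rewrite catA nth_cat size_cat ltnNge leq_addr addKn.
have setE d y (r : seq nat) : set_nth 0 (a ++ b ++ r) (size a + size b + d) y =
    a ++ b ++ set_nth 0 r d y.
  rewrite !catA -size_cat; elim: (a ++ b) => //= z w IHw.
  by rewrite IHw.
have := setE 1 x; have := setE 0; have := nthE 1; have := nthE 0.
by rewrite addn0 addn1 => -> -> -> ->.
Qed.

(** The induction hypothesis describes a list in the middle of the computation:
    beyond position [j.+1], where [j] bounds the labels [h] already used, it is
    still the identity, and the positions prescribed so far are at most [k], the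
    last label [t] used.  The next step thus moves the value [x.+1] from
    position [x.+1] to position [y], to the right of everything prescribed, and
    the remaining values keep their relative order. *)
Lemma foldl_sigma_fills n h t s pos vals j k :
  fills n pos vals s -> drop j.+1 s = iota j.+2 (n - j.+1) ->
  all (geq k) pos -> path ltn j h -> path ltn k t -> all (gtn n) h ->
  all2 geq h t ->
  fills n (pos ++ t) (vals ++ map S h) (foldl sigma s (zip h t)).
Proof.
elim: h t s pos vals j k => [|x h IHh] [|y t] s pos vals j k //=.
  by rewrite !cats0.
move=> [s_perm pos_n s_pos s_inc] s_tail pos_k /andP[jx xh] /andP[ky yt].
case/andP=> xn hn /andP[yx ht].
have sz_s : size s = n by rewrite (perm_size s_perm) size_iota.
(* [a], [b] and [c] are the parts before y, crossed by x.+1, and after it. *)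
set a := take y.-1 s; set b := drop y.-1 (take x s).
set c := iota x.+2 (n - x.+1).
have sz_a : size a = y.-1 by rewrite size_take_min; lia.
have sz_b : size b = x - y.-1 by rewrite size_drop size_take_min; lia.
have s_eq : s = a ++ b ++ x.+1 :: c.
  rewrite -[LHS](cat_take_drop x) catA; congr cat.
    rewrite -[LHS](cat_take_drop y.-1); congr cat.
    by rewrite take_takel //; lia.
  have -> : x = x - j.+1 + j.+1 by lia.
  rewrite -drop_drop s_tail drop_iota.
  have -> : n - j.+1 - (x - j.+1) = (n - x.+1).+1 by lia.
  by rewrite /c /=; congr (_ :: iota _ _); lia.
have -> : sigma s (x, y) = a ++ x.+1 :: b ++ c.
  rewrite s_eq -sigmaE; congr (sigma _ (_, _)); lia.
rewrite -cat_rcons -[vals ++ _]cat_rcons; apply: (IHh _ _ _ _ x y) => //.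
- split.
  + rewrite -(permPr s_perm) s_eq perm_cat2l.
    exact: (permEl (perm_catCA [:: x.+1] b c)).
  + by rewrite all_rcons pos_n andbT; lia.
  + rewrite map_rcons nth_cat sz_a ltnn subnn /=; congr rcons.
    rewrite -s_pos; apply/eq_in_map => /= p p_pos.
    have /= p_k := allP pos_k _ p_pos; have /= p_n := allP pos_n _ p_pos.
    have lt_py : p.-1 < y.-1 by lia.
    by rewrite s_eq !nth_cat sz_a lt_py.
  have -> : [seq z <- a ++ x.+1 :: b ++ c | z \notin rcons vals x.+1] =
      [seq z <- [seq z <- s | z \notin vals] | z != x.+1].
    rewrite -filter_predI s_eq !filter_cat /= !filter_cat.
    rewrite mem_rcons mem_head eqxx /=.
    by congr (_ ++ (_ ++ _)); apply: eq_filter => z /=;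
      rewrite mem_rcons inE negb_or.
  exact: sorted_filter ltn_trans _ _ s_inc.
- rewrite -cat_rcons catA drop_size_cat // size_cat size_rcons; lia.
- rewrite all_rcons /= leqnn /=; apply: sub_all pos_k => p /=; lia.
Qed.

Lemma M_fills (P : dyck) :
  fills (dsize P) (tlabels P) (map S (hlabels P)) (M P).
Proof.
have /and5P[h_sorted t_sorted /allP h_n /allP t_n ht] := labels_valid P.
have path0 l : sorted ltn l -> {in l, forall x, 0 < x < dsize P} ->
    path ltn 0 l.
  case: l => //= x l -> /(_ x (mem_head _ _)); lia.
apply: (@foldl_sigma_fills _ _ _ _ [::] [::] 0 0) => //.
- split=> //; rewrite filter_predT; exact: iota_ltn_sorted.
- by rewrite drop_iota; congr iota; lia.
- exact: path0.
- exact: path0.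
by apply/allP => x /h_n /=; lia.
Qed.

Lemma M_eq_BL : M =1 B \o L.
Proof.
move=> P; rewrite /= /B; have [-> -> ->] := LP P.
by rewrite (fills_fill (M_fills P)).
Qed.

(** * Labels and codes of elevated paths and of concatenations *)

Lemma total_cat r s : total (r ++ s) = total r + total s.
Proof. by rewrite /total map_cat sumn_cat. Qed.

Lemma ends_cat k r s : ends k (r ++ s) = ends k r ++ ends (k + total r) s.
Proof.
elim: r k => [|x r IHr] k /=; first by rewrite addn0.
by rewrite IHr /total /= addnA.
Qed.

Lemma doubles_cat k r s :
  doubles k (r ++ s) = doubles k r ++ doubles (k + total r) s.
Proof.
elim: r k => [|x r IHr] k /=; first by rewrite addn0.
by rewrite IHr catA /total /= addnA.
Qed.

Lemma ends_shift m k s : ends (m + k) s = map (addn m) (ends k s).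
Proof. by elim: s k => //= x s IHs k; rewrite -addnA IHs. Qed.

Lemma doubles_shift m k s : doubles (m + k) s = map (addn m) (doubles k s).
Proof.
by elim: s k => //= x s IHs k; rewrite map_cat -iotaDl (addnS m k) -addnA IHs.
Qed.

Lemma size_ends k s : size (ends k s) = size s.
Proof. by elim: s k => //= x s IHs k; rewrite IHs. Qed.

Lemma blocks_cat r s : blocks (r ++ s) = blocks r ++ blocks s.
Proof. by rewrite /blocks map_cat flatten_cat. Qed.

(** [r] and [s] are the ascent and descent lengths of [w], each diminished by 1,
    as in [blocks], [ends] and [doubles]. *)
Definition shape (w : seq bool) (r s : seq nat) : Prop :=
  exists l, [/\ w = blocks l, unzip1 l = r & unzip2 l = s].

Lemma shape_ex (P : dyck) : exists r s, shape P r s /\ total r = total s.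
Proof.
have [l Pl] := blocks_ex P; exists (unzip1 l), (unzip2 l).
split; first by exists l.
have DP := dyckP P; rewrite Pl in DP.
by rewrite -(dyck_blocks_total DP).
Qed.

Lemma shape_nonempty w r s : shape w r s -> w != [::] ->
  exists a r' s' d, r = a :: r' /\ s = rcons s' d.
Proof.
case=> -[|[a d] l] [-> <- <-] //= _.
exists a, (unzip1 l), (belast d (unzip2 l)), (last d (unzip2 l)).
by rewrite -lastI.
Qed.

Lemma shape_cat v w r s r' s' : shape v r s -> shape w r' s' ->
  shape (v ++ w) (r ++ r') (s ++ s').
Proof.
case=> l [-> <- <-] [l' [-> <- <-]]; exists (l ++ l').
by rewrite blocks_cat /unzip1 /unzip2 !map_cat.
Qed.

(** Elevation lengthens the first ascent and the last descent by one. *)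
Lemma shape_elevate w a r s d : shape w (a :: r) (rcons s d) ->
  shape (up :: rcons w down) (a.+1 :: r) (rcons s d.+1).
Proof.
case=> l [-> l1 l2].
have {l l1 l2} [l [-> l1 l2]] :
    shape (rcons (blocks l) down) (a :: r) (rcons s d.+1).
  case/lastP: l l1 l2 => [|l [a' d']]; first by case: s.
  rewrite /unzip1 /unzip2 !map_rcons => <- /rcons_inj[<- <-] /=.
  exists (rcons l (a', d'.+1)); rewrite /unzip1 /unzip2 !map_rcons; split=> //.
  rewrite -!cats1 !blocks_cat -catA; congr cat.
  rewrite /blocks /= !cats0 -catA; congr (_ :: _ ++ _ :: _).
  by elim: d' => //= k ->.
case: l l1 l2 => // -[a' d'] l [<- <-] <-.
by exists ((a'.+1, d') :: l).
Qed.

Lemma shape_labels w r s : shape w r s ->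
  [/\ tlabels w = doubles 0 r, hlabels w = doubles 0 s & dsize w = total r].
Proof.
by case=> l [-> <- <-]; rewrite tlabels_blocks hlabels_blocks dsize_blocks.
Qed.

Lemma shape_code w r s : shape w r s ->
  codeA w = take (size r).-1 (ends 0 r) /\
  codeD w = take (size s).-1 (ends 0 s).
Proof.
case=> l [-> <- <-]; rewrite /codeA /codeD runs_up_blocks runs_down_blocks.
rewrite !size_map (map_comp S fst) (map_comp S snd).
by rewrite !psums_ends ?size_map ?leq_pred.
Qed.

Lemma rcons_take_ends r : r != [::] ->
  rcons (take (size r).-1 (ends 0 r)) (total r) = ends 0 r.
Proof.
case/lastP: r => // r a _; rewrite size_rcons -(cats1 r a) ends_cat total_cat.
by rewrite take_size_cat ?size_ends // cats1 /total /= addn0.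
Qed.

(** With the size appended, the two halves of a code list the ends of all the
    ascents, resp. descents, and these lists behave well under concatenation. *)
Lemma code_rcons (P : dyck) r s : shape P r s -> total r = total s ->
  P != [::] :> seq bool ->
  rcons (codeA P) (dsize P) = ends 0 r /\ rcons (codeD P) (dsize P) = ends 0 s.
Proof.
move=> Prs rs P0; have [-> ->] := shape_code Prs.
have [_ _ ->] := shape_labels Prs.
have [a [r' [s' [d [r_eq s_eq]]]]] := shape_nonempty Prs P0.
rewrite {2}rs !rcons_take_ends // ?r_eq // s_eq.
by case: (s').
Qed.

Lemma dsize_elevate (P : dyck) : dsize (elevate P) = (dsize P).+1.
Proof. by rewrite /dsize /= -cats1 count_cat /= add1n !addn0. Qed.

Lemma dsize_cat (P Q : dyck) : dsize (dyck_cat P Q) = dsize P + dsize Q.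
Proof. exact: count_cat. Qed.

(** The ends of the ascents are all shifted by the initial u, while the final d
    moves only the end of the last descent, which the code leaves out. *)
Lemma code_elevate (P : dyck) :
  codeA (elevate P) = map S (codeA P) /\ codeD (elevate P) = codeD P.
Proof.
have [r [s [Prs _]]] := shape_ex P.
have [P0|P0] := eqVneq (P : seq bool) [::]; first by rewrite /= P0.
have [a [r' [s' [d [r_eq s_eq]]]]] := shape_nonempty Prs P0.
rewrite r_eq s_eq in Prs.
have [-> ->] := shape_code Prs.
have [-> ->] := shape_code (shape_elevate Prs).
rewrite !size_rcons /= -!cats1 !ends_cat !take_size_cat ?size_ends //.
by rewrite map_take -(ends_shift 1 0 (a :: r')).
Qed.

(** A new uu starts with the initial u, and a new dd starts with the last d of
    [P], whose label is the size of [P]. *)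
Lemma labels_elevate (P : dyck) : P != [::] :> seq bool ->
  tlabels (elevate P) = 1 :: map S (tlabels P) /\
  hlabels (elevate P) = rcons (hlabels P) (dsize P).
Proof.
move=> P0; have [r [s [Prs rs]]] := shape_ex P.
have [a [r' [s' [d [r_eq s_eq]]]]] := shape_nonempty Prs P0.
rewrite r_eq s_eq in Prs rs.
have [-> -> ->] := shape_labels Prs.
have [-> -> _] := shape_labels (shape_elevate Prs).
split; first by rewrite -(doubles_shift 1).
rewrite rs -!cats1 !doubles_cat total_cat -catA /= !cats0; congr cat.
have iota_rcons m : m :: iota m.+1 d = iota m d ++ [:: m + d].
  by rewrite -[LHS]/(iota m d.+1) -(addn1 d) iotaD.
by rewrite iota_rcons add0n /total /= addn0 addSnnS.
Qed.

Lemma labels_cat (P Q : dyck) :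
  tlabels (dyck_cat P Q) = tlabels P ++ map (addn (dsize P)) (tlabels Q) /\
  hlabels (dyck_cat P Q) = hlabels P ++ map (addn (dsize P)) (hlabels Q).
Proof.
have [r [s [Prs rs]]] := shape_ex P; have [r' [s' [Qrs _]]] := shape_ex Q.
have [-> -> ->] := shape_labels Prs; have [-> -> _] := shape_labels Qrs.
have [/= -> -> _] := shape_labels (shape_cat Prs Qrs).
by rewrite !doubles_cat -rs -!doubles_shift addn0.
Qed.

(** The last peak of [P] becomes an inner one, which adds one entry to each half
    of the code. *)
Lemma code_cat (P Q : dyck) : P != [::] :> seq bool -> Q != [::] :> seq bool ->
  codeA (dyck_cat P Q) =
    codeA P ++ dsize P :: map (addn (dsize P)) (codeA Q) /\
  codeD (dyck_cat P Q) =
    codeD P ++ dsize P :: map (addn (dsize P)) (codeD Q).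
Proof.
move=> P0 Q0.
have [r [s [Prs rs]]] := shape_ex P; have [r' [s' [Qrs rs']]] := shape_ex Q.
have PQ0 : dyck_cat P Q != [::] :> seq bool.
  by move: P0 => /=; case: (dyck_word P).
have rs'' : total (r ++ r') = total (s ++ s') by rewrite !total_cat rs rs'.
have [AP DP] := code_rcons Prs rs P0; have [AQ DQ] := code_rcons Qrs rs' Q0.
have [APQ DPQ] := code_rcons (P := dyck_cat P Q) (shape_cat Prs Qrs) rs'' PQ0.
have [_ _ szP] := shape_labels Prs.
have rconsK z (u v : seq nat) : rcons u z = rcons v z -> u = v.
  by move/rcons_inj=> -[].
split; apply: (rconsK (dsize (dyck_cat P Q))).
  rewrite APQ ends_cat -AP -szP -[0 + _]addnC ends_shift -AQ.
  by rewrite map_rcons cat_rcons dsize_cat -rcons_cons -rcons_cat.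
rewrite DPQ ends_cat -DP -rs -szP -[0 + _]addnC ends_shift -DQ.
by rewrite map_rcons cat_rcons dsize_cat -rcons_cons -rcons_cat.
Qed.

(** * The bijection K on paths with given components *)

Definition Kpos (P : dyck) : seq nat := [seq d.+1 | d <- 0 :: codeD P].
Definition Kvals (P : dyck) : seq nat := rcons (codeA P) (dsize P).

Lemma Kpos_cat (P Q : dyck) : P != [::] :> seq bool -> Q != [::] :> seq bool ->
  Kpos (dyck_cat P Q) = Kpos P ++ map (addn (dsize P)) (Kpos Q).
Proof.
move=> P0 Q0; rewrite /Kpos (code_cat P0 Q0).2 -cat_cons map_cat; congr cat.
rewrite /= addn1; congr cons; rewrite -!map_comp.
by apply: eq_map => d /=; rewrite addnS.
Qed.

Lemma Kvals_cat (P Q : dyck) : P != [::] :> seq bool -> Q != [::] :> seq bool ->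
  Kvals (dyck_cat P Q) = Kvals P ++ map (addn (dsize P)) (Kvals Q).
Proof.
move=> P0 Q0; rewrite /Kvals (code_cat P0 Q0).1 dsize_cat map_rcons.
by rewrite cat_rcons -rcons_cons -rcons_cat.
Qed.

(** When [P] is empty, the position and the value 1 that K prescribes are the
    ones left over by B. When [P] is not empty, the two prescriptions are equal,
    and M provides a solution. *)
Lemma fills_elevate (P : dyck) : exists s,
  fills (dsize (elevate P)) (tlabels (elevate P))
    (map S (hlabels (elevate P))) s /\
  fills (dsize (elevate P)) (Kpos (elevate (L P))) (Kvals (elevate (L P))) s.
Proof.
have [P0|P0] := eqVneq (P : seq bool) [::].
  have -> : P = dyck_empty by apply: val_inj.
  by exists [:: 1].
exists (M (elevate P)); split; first exact: M_fills.
have := M_fills (elevate P); have [-> ->] := labels_elevate P0.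
rewrite /Kpos /Kvals; have [-> ->] := code_elevate (L P).
by have [n_eq -> ->] := LP P; rewrite !dsize_elevate n_eq map_rcons.
Qed.

Lemma dsize_join_L (Ps : seq dyck) :
  dsize (join (map L Ps)) = dsize (join Ps).
Proof.
have joinE Q Qs : dsize (join (Q :: Qs)) = (dsize Q).+1 + dsize (join Qs).
  by rewrite -dsize_elevate; apply: (dsize_cat (elevate Q)).
elim: Ps => [//|P Ps IHPs]; have [szP _ _] := LP P.
by rewrite map_cons !joinE IHPs szP.
Qed.

Lemma fills_join (Ps : seq dyck) : Ps != [::] -> exists s,
  fills (dsize (join Ps)) (tlabels (join Ps)) (map S (hlabels (join Ps))) s /\
  fills (dsize (join Ps)) (Kpos (join (map L Ps))) (Kvals (join (map L Ps))) s.
Proof.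
elim: Ps => // P Ps IHPs _.
have [sP [BP KP]] := fills_elevate P.
have [Ps0|Ps0] := eqVneq Ps [::].
  have joinE Q : join [:: Q] = elevate Q by apply: val_inj; rewrite /= cats0.
  by rewrite Ps0 [map L _]/= !joinE; exists sP.
have [s [Bs Ks]] := IHPs Ps0.
have size_L : dsize (elevate (L P)) = dsize (elevate P).
  by have [szP _ _] := LP P; rewrite !dsize_elevate szP.
have LPs0 : join (map L Ps) != [::] :> seq bool by case: (Ps) Ps0.
exists (sP ++ map (addn (dsize (elevate P))) s).
have -> : join (P :: Ps) = dyck_cat (elevate P) (join Ps) by [].
have -> : join (map L (P :: Ps)) =
  dyck_cat (elevate (L P)) (join (map L Ps)) by [].
rewrite dsize_cat (labels_cat _ _).1 (labels_cat _ _).2 map_cat.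
rewrite Kpos_cat // Kvals_cat // size_L; split; last exact: fills_cat.
rewrite -map_comp; have -> : map (S \o addn (dsize (elevate P)))
    (hlabels (join Ps)) = map (addn (dsize (elevate P)))
    (map S (hlabels (join Ps))).
  by rewrite -map_comp; apply: eq_map => x /=; rewrite addnS.
exact: fills_cat.
Qed.

Theorem mainTheorem1 :
  (M =1 B \o L) /\ (B \o L =1 K \o derivative L).
Proof.
split=> P; first exact: M_eq_BL.
rewrite -M_eq_BL -(componentsK P) /= derivativeE.
have [->|Ps0] := eqVneq (components P) [::]; first by [].
have [s [Bs Ks]] := fills_join Ps0.
rewrite -(fills_fill (M_fills _)) (fills_fill Bs).
rewrite -[RHS]/(fill (dsize _) (Kpos _) (Kvals _)) dsize_join_L.
by rewrite (fills_fill Ks).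
Qed.
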